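(* There is an absolute constant $C$ such that for every integer $n\ge 4$ and every forest $F$ on $n$ vertices, $\mathrm{cp}(\overline{F})\le C\, n\log\log n$; that is, $\mathrm{cp}(\overline{F})=O(n\log\log n)$.
   Context: Logarithms are base $2$. A clique partition of a graph $G$ is a collection of complete subgraphs of $G$ whose edge sets partition $E(G)$; the clique partition number $\mathrm{cp}(G)$ is the minimum number of cliques in a clique partition of $G$. $\overline{F}$ denotes the complement of the graph $F$ (on the same vertex set). *)

(* Defs.v *)
From HB Require Import structures.
From mathcomp Require Import all_boot all_order all_algebra.
From mathcomp Require Import reals exp.

Set Implicit Arguments.
Unset Strict Implicit.
Unset Printing Implicit Defensive.

Record sgraph (T : finType) := SGraph {
  edge :> rel T;
  edge_sym : symmetric edge;
  edge_irr : irreflexive edge }.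

Section Graphs.
Variable T : finType.
Implicit Types (G : sgraph T) (K : {set T}) (P : {set {set T}}).

Definition compl_edge G : rel T := [rel x y | (x != y) && ~~ G x y].

Lemma compl_edge_sym G : symmetric (compl_edge G).
Proof. by move=> x y; rewrite /compl_edge /= eq_sym edge_sym. Qed.

Lemma compl_edge_irr G : irreflexive (compl_edge G).
Proof. by move=> x; rewrite /compl_edge /= eqxx. Qed.

Definition complement G : sgraph T :=
  SGraph (@compl_edge_sym G) (@compl_edge_irr G).

(* [ucycle] also holds of the empty sequence and of [:: x; y] when x and y are
   adjacent; the cycles of a simple graph are those of length at least 3. *)
Definition forest G : Prop := forall c : seq T, ucycle G c -> size c < 3.

Definition edges G : {set {set T}} :=
  [set [set p.1; p.2] | p in [pred p : T * T | G p.1 p.2]].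

(* A complete subgraph is represented by its vertex set. *)
Definition clique G K : bool :=
  [forall x in K, forall y in K, (x != y) ==> G x y].

Definition clique_edges K : {set {set T}} :=
  [set [set p.1; p.2] | p in [pred p : T * T |
     [&& p.1 \in K, p.2 \in K & p.1 != p.2]]].

(* [partition] requires nonempty blocks, so the members of P have at least two
   vertices; [clique_edges] is then injective on P, and no edge is covered by
   two members of P. *)
Definition clique_partition G P : bool :=
  [forall K in P, clique G K] &&
  partition [set clique_edges K | K in P] (edges G).

(* The default value is the partition into single edges, see [edges_cp]. *)
Definition cp G : nat :=
  #|[arg min_(P < edges G | clique_partition G P) #|P| ]|.

Lemma clique_edges2 (x y : T) : x != y ->
  clique_edges [set x; y] = [set [set x; y]].
Proof.
move=> nxy; apply/setP=> e; rewrite inE; apply/imsetP/eqP => [[[a b]]|->].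
  rewrite !inE /= => /and3P[/orP[]/eqP-> /orP[]/eqP->]; rewrite ?eqxx // => _ ->//.
  by rewrite setUC.
by exists (x, y) => //; rewrite !inE /= !eqxx orbT nxy.
Qed.

Lemma edges_cp G : clique_partition G (edges G).
Proof.
have nG x y : G x y -> x != y.
  by apply: contraTneq => ->; rewrite edge_irr.
have ceE : {in edges G, clique_edges =1 set1}.
  by move=> _ /imsetP[[x y]] /= Gxy ->; rewrite clique_edges2 ?nG.
apply/andP; split.
  apply/forall_inP=> _ /imsetP[[x y] /= Gxy ->].
  apply/forall_inP=> a; rewrite !inE => Ha; apply/forall_inP=> b.
  rewrite !inE => Hb; apply/implyP; move: Gxy; rewrite inE /= => Gxy.
  by case/orP: Ha Hb => /eqP-> /orP[]/eqP->; rewrite ?eqxx // edge_sym.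
rewrite (eq_in_imset ceE); apply/and3P; split.
- apply/eqP/setP=> e; rewrite /cover; apply/bigcupP/idP.
    by case=> _ /imsetP[f fG ->]; rewrite inE => /eqP->.
  by move=> eG; exists [set e]; rewrite ?imset_f ?inE.
- apply/trivIsetP=> _ _ /imsetP[e _ ->] /imsetP[f _ ->] nef.
  by rewrite disjoints1 inE; apply: contraNneq nef => ->.
- by apply/imsetP=> -[e _ /setP/(_ e)]; rewrite !inE eqxx.
Qed.

Lemma cp_exists G : exists2 P, clique_partition G P & #|P| = cp G.
Proof. by rewrite /cp; case: arg_minnP; [exact: edges_cp|move=> P; exists P]. Qed.

Lemma cp_min G P : clique_partition G P -> cp G <= #|P|.
Proof. by rewrite /cp; case: arg_minnP; [exact: edges_cp|move=> Q _; apply]. Qed.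

End Graphs.

Definition log2 (R : realType) (x : R) : R := (ln x / ln 2%:R)%R.

(* Main.v *)
Require Import Defs.
From HB Require Import structures.
From mathcomp Require Import all_boot all_order all_algebra all_field.
From mathcomp Require Import reals exp.
From mathcomp Require Import zify.

(* Let q be a power of 2 of order sqrt n. Cutting a set S of O(q) vertices leaves
   components with at most q/2 vertices, each of which has a single root whose
   parent may lie in S. Spread the vertices outside S over the affine plane of
   order q, every component inside one column, and make each s in S the point at
   infinity of its own slope. The non-vertical lines, each with its point at
   infinity, are q^2 = O(n) cliques, except that s has to be left out of the
   lines on which it has a neighbour. Since the component roots below s can be
   packed into few lines of slope s, there are only O(q) exceptional lines, so
   the missing edges at S can be taken one by one at a total cost of O(q^2).
   The columns partition the vertices outside S and have at most q vertices;
   recursing into them costs O(n) per level, and there are O(log log n)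
   levels. *)

Set Implicit Arguments.
Unset Strict Implicit.
Unset Printing Implicit Defensive.

Import Order.TTheory GRing.Theory Num.Theory.

(** * Injections between finite sets *)

Lemma exists_inj_on (T K : finType) (k0 : K) (B : {set T}) (D : {set K}) :
  #|B| <= #|D| ->
  exists f : T -> K, {in B &, injective f} /\ {in B, forall x, f x \in D}.
Proof.
move=> leBD; exists (fun x => nth k0 (enum D) (index x (enum B))).
have idx x : x \in B -> index x (enum B) < size (enum D).
  by move=> xB; rewrite -cardE (leq_trans _ leBD) // cardE index_mem mem_enum.
split=> [x y xB yB|x xB]; last by rewrite -mem_enum mem_nth ?idx.
move/eqP; rewrite nth_uniq ?idx ?enum_uniq // => /eqP eqi.
have xe : x \in enum B by rewrite mem_enum.
have ye : y \in enum B by rewrite mem_enum.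
by rewrite -(nth_index x xe) eqi nth_index.
Qed.

Lemma extend_inj_on (T K : finType) (k0 : K) (D V : {set T}) (f : T -> K) :
  D \subset V -> {in D &, injective f} -> #|V| <= #|K| ->
  exists2 g : T -> K, {in V &, injective g} & {in D, g =1 f}.
Proof.
move=> sDV injf leVK.
have [|g [injg gP]] := @exists_inj_on T K k0 (V :\: D) (~: (f @: D)).
  have := cardsCs (f @: D); have := max_card (mem (f @: D)).
  have := cardsID D V; rewrite (setIidPr sDV) card_in_imset //; lia.
exists (fun x => if x \in D then f x else g x); last by move=> x ->.
have disj x y : x \in D -> y \in V -> y \notin D -> f x = g y -> False.
  move=> xD yV yD eqfg; have := gP y; rewrite !inE yV yD -eqfg imset_f //.
  by move=> /(_ isT).
move=> x y xV yV; case: ifP => xD; case: ifP => yD; first exact: injf.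
- by move/(disj _ _ xD yV (negbT yD)).
- by move/esym/(disj _ _ yD xV (negbT xD)).
- by apply: injg; rewrite !inE ?xD ?yD.
Qed.

(** * Leaves and parent functions of forests *)

Section ForestStructure.
Variables (T : finType) (F : sgraph T).

(** Otherwise every vertex of [A] has two neighbours in [A], so a path can be prolonged at its head
    without turning back. It never meets itself, since that would close a cycle, and so it outgrows
    [A]. *)
Lemma forest_leaf (A : {set T}) (a : T) : forest F -> a \in A ->
  exists2 v, v \in A & {in A &, forall x y, F v x -> F v y -> x = y}.
Proof.
move=> forF aA.
case: (pickP [pred v | (v \in A) &&
  [forall x in A, forall y in A, (F v x && F v y) ==> (x == y)]]) => /= [v|noleaf].
  case/andP=> vA /forall_inP uniqv; exists v => // x y xA yA Fvx Fvy.
  move/forall_inP: (uniqv x xA) => /(_ y yA); rewrite Fvx Fvy.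
  by move/eqP.
have two v h : v \in A -> exists z, [/\ z \in A, F v z & z != h].
  move=> vA; have /= := noleaf v; rewrite vA /= => /negbT/forall_inPn[x xA].
  case/forall_inPn=> y yA; rewrite negb_imply => /andP[/andP[Fvx Fvy] nxy].
  have [xh|nxh] := eqVneq x h; last by exists x.
  by exists y; split; rewrite // -xh eq_sym.
suff long n : exists x p, [/\ uniq (x :: p), path F x p,
    {subset x :: p <= A} & size p = n].
  have [x [p [u _ sub sz]]] := long #|A|.
  have: size (x :: p) <= #|A|.
    by rewrite cardE uniq_leq_size // => z /sub; rewrite mem_enum.
  by rewrite /= sz ltnn.
elim: n => [|n [x [p [u pp sub sz]]]].
  by exists a, [::]; split=> // z; rewrite inE => /eqP->.
have xA : x \in A by rewrite sub ?mem_head.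
have [z [zA Fxz nzh]] := two x (head x p) xA.
have nzx : z != x by apply: contraTneq Fxz => ->; rewrite edge_irr.
have [zp|zp] := boolP (z \in p); last first.
  exists z, (x :: p); split=> //=; last by rewrite sz.
  - by rewrite inE negb_or nzx zp.
  - by rewrite edge_sym Fxz.
  - by move=> y; rewrite inE => /predU1P[->|/sub].
(* [z] is not the vertex right after [x], so [p1] is nonempty and the cycle closed by [z] has at
   least three vertices. *)
exfalso; case/splitPr: zp => p1 p2 in u pp nzh *.
case: p1 => [|h p1] in u pp nzh *; first by rewrite /= eqxx in nzh.
suff: ucycle F (x :: rcons (h :: p1) z).
  by move/forF; rewrite /= size_rcons.
rewrite -cat_rcons -cat_cons cat_uniq in u; case/andP: u => u _.
rewrite -cat_rcons cat_path in pp; case/andP: pp => pp _.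
by rewrite /ucycle u andbT /cycle rcons_path pp last_rcons edge_sym.
Qed.

(** Leaves are peeled off one at a time. The only neighbour that a leaf has left becomes its parent;
    the leaf gets rank 0 and all later ranks move up by one. *)
Lemma forest_parent : forest F ->
  exists (p : T -> option T) (r : T -> nat),
    (forall x y, F x y -> p x = Some y \/ p y = Some x) /\
    (forall x y, p x = Some y -> r x < r y).
Proof.
move=> forF.
suff peel n (A : {set T}) : #|A| = n -> exists (p : T -> option T) (r : T -> nat),
    [/\ {in A &, forall x y, F x y -> p x = Some y \/ p y = Some x},
        forall x y, p x = Some y -> y \in A &
        forall x y, p x = Some y -> r x < r y].
  have [p [r [pF _ pr]]] := peel _ _ (erefl #|[set: T]|).
  by exists p, r; split=> // x y; apply: pF; rewrite inE.
elim: n A => [|n IHn] A cardA.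
  exists (fun=> None), (fun=> 0); split=> // x y.
  by move/eqP: cardA; rewrite cards_eq0 => /eqP->; rewrite inE.
have /card_gt0P[a aA] : 0 < #|A| by rewrite cardA.
have [v vA vleaf] := forest_leaf forF aA.
have [|p [r [pF pA pr]]] := IHn (A :\ v).
  by apply/eqP; rewrite -eqSS -cardA (cardsD1 v A) vA.
exists (fun x => if x == v then [pick y in A | F v y] else p x).
exists (fun x => if x == v then 0 else (r x).+1).
have pv y : [pick y in A | F v y] = Some y -> (y \in A) && F v y.
  by case: pickP => // z zP [<-].
have vP y : y \in A -> F v y -> [pick y in A | F v y] = Some y.
  move=> yA Fvy; case: pickP => [z /andP[zA Fvz]|/(_ y)]; last by rewrite yA Fvy.
  by congr Some; exact: vleaf.
split=> [x y xA yA Fxy|x y|x y].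
- have [xv|nxv] := eqVneq x v; first by left; apply: vP; rewrite // -xv.
  have [yv|nyv] := eqVneq y v; first by right; apply: vP; rewrite // -yv edge_sym.
  by apply: pF; rewrite // !inE ?nxv ?nyv.
- by case: eqP => _ => [/pv/andP[]//|/pA]; rewrite inE => /andP[].
- case: eqVneq => [_ /pv/andP[_ Fvy]|nxv pxy].
    by rewrite ifF //; apply: contraTF Fvy => /eqP->; rewrite edge_irr.
  have := pA _ _ pxy; rewrite !inE => /andP[/negPf-> _].
  by rewrite ltnS pr.
Qed.

End ForestStructure.

(** * Cutting a forest into small rooted components *)

Section Separator.
Variables (T : finType) (F : sgraph T) (p : T -> option T) (r : T -> nat).
Hypothesis pF : forall x y, F x y -> p x = Some y \/ p y = Some x.
Hypothesis pr : forall x y, p x = Some y -> r x < r y.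

Definition under (S : {set T}) (x : T) := oapp [in S] false (p x).

(** [rho] sends a vertex to the root of its component outside [S]. Vertices are treated by
    increasing rank: a new vertex [v] absorbs the components hanging below it if the result has at
    most [h] vertices. Otherwise [v] enters [S] and is charged to the [h] or more vertices below
    it. *)
Lemma separator (h : nat) (A : {set T}) : exists (S : {set T}) (rho : T -> T),
  let V := A :\: S in
  [/\ S \subset A,
      {in V, forall x, rho x \in V /\ rho (rho x) = rho x},
      {in V &, forall x y, F x y -> rho x = rho y},
      {in V, forall x, rho x != x -> exists2 y, y \in V & p x = Some y} &
      (forall z, #|[set x in V | rho x == z]| <= h) /\
      h * #|S| <= #|[set x in V | under S (rho x)]|].
Proof.
have [n] := ubnP #|A|; elim: n A => // n IHn A leAn.
have [->|[a aA]] := set_0Vmem A.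
  exists set0, id; rewrite set0D /=; split=> [|x|x y|x|]; rewrite ?sub0set ?inE //.
  split=> [z|]; last by rewrite cards0 muln0.
  by rewrite eq_card0 // => x; rewrite !inE.
case: (arg_maxnP r aA) => v vA vmax; rewrite -/([in A] v) in vA.
have [|S [rho [sSA rhoV rhoF rhoN [fib szS]]]] := IHn (A :\ v).
  by have := cardsD1 v A; rewrite [v \in A]vA; lia.
set V := (A :\ v) :\: S in rhoV rhoF rhoN fib szS.
have vnV : v \notin V by rewrite !inE eqxx andbF.
have vnS : v \notin S by apply/negP=> /(subsetP sSA); rewrite !inE eqxx.
have pvA y : p v = Some y -> y \notin A.
  by move=> /pr ltvy; apply/negP=> /vmax; rewrite /= leqNgt ltvy.
have VA x : x \in V -> x \in A by rewrite !inE => /and3P[].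
(* The parent of [v] lies outside [A] because [v] has maximal rank, so all neighbours of [v] in [V]
   are children; they are roots since [v] is not in [V]. *)
have child x : x \in V -> F v x -> p x = Some v /\ rho x = x.
  move=> xV /pF[/pvA|pxv]; first by rewrite VA.
  split=> //; apply/eqP; apply: contraT => /(rhoN _ xV)[y yV].
  by rewrite pxv => -[vy]; rewrite vy yV in vnV.
pose M := [set x in V | p (rho x) == Some v].
have [leM|ltM] := ltnP #|M| h.
  have eV : A :\: S = v |: V.
    by apply/setP=> x; rewrite !inE; case: eqVneq => [->|]; rewrite ?vnS.
  pose rho' x := if (x == v) || (p (rho x) == Some v) then v else rho x.
  have vv : rho' v = v by rewrite /rho' eqxx.
  have Vv x : x \in V -> (x == v) = false.
    by move=> xV; apply: contraTF xV => /eqP->.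
  exists S, rho'; rewrite eV /=; split.
  - by rewrite (subset_trans sSA) ?subsetDl.
  - move=> x /setU1P[->|xV]; first by rewrite vv setU11.
    have [rV rr] := rhoV _ xV.
    rewrite {1 3 4}/rho' Vv //=; case: ifP => [_|pn]; first by rewrite vv setU11.
    by rewrite /rho' rr pn Vv // orbF setU1r.
  - move=> x y /setU1P[->|xV] /setU1P[->|yV] Fxy //.
    + by have [py ry] := child _ yV Fxy; rewrite vv /rho' ry py eqxx orbT.
    + rewrite edge_sym in Fxy; have [px rx] := child _ xV Fxy.
      by rewrite vv /rho' rx px eqxx orbT.
    + by rewrite /rho' !Vv //= (rhoF x y).
  - move=> x /setU1P[->|xV]; first by rewrite vv eqxx.
    have [rx|/(rhoN _ xV)[y yV py] _] := eqVneq (rho x) x; last first.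
      by exists y => //; rewrite setU1r.
    rewrite /rho' Vv //= rx.
    have [px _|_] := eqVneq (p x) (Some v); last by rewrite eqxx.
    by exists v; rewrite ?setU11.
  - split=> [z|].
      have [->|nzv] := eqVneq z v.
        apply: leq_trans leM.
        have -> : [set x in v |: V | rho' x == v] = v |: M.
          apply/setP=> x; rewrite !inE /rho'; case: eqVneq => [->|nxv] //=.
            by rewrite eqxx.
          case xV: (x \in V); move: (xV); rewrite !inE nxv /= => -> //=.
          case: ifP => [_|_]; first by rewrite eqxx.
          have [rV _] := rhoV _ xV; rewrite Vv //.
        by rewrite cardsU1 inE (negPf vnV).
      apply: leq_trans (fib z); apply: subset_leq_card; apply/subsetP=> x.
      rewrite inE => /andP[/setU1P[->|xV]]; first by rewrite vv eq_sym (negPf nzv).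
      rewrite /rho' Vv //=; case: ifP => _; first by rewrite eq_sym (negPf nzv).
      by move=> rx; rewrite inE xV.
    apply: (leq_trans szS); apply: subset_leq_card; apply/subsetP=> x.
    rewrite [x \in _]inE => /andP[xV ux]; rewrite inE setU1r //=.
    rewrite /rho' Vv //=; case: eqP => // px.
    by move: ux; rewrite /under px /= => vS; rewrite vS in vnS.
(* Here [v] joins [S]; the vertices of [M] pay for it. *)
have eV : A :\: (v |: S) = V.
  by apply/setP=> x; rewrite !inE; case: eqVneq; rewrite ?andbF.
exists (v |: S), rho; rewrite eV /=; split=> //.
  by rewrite subUset sub1set vA (subset_trans sSA) ?subsetDl.
split=> //; rewrite cardsU1 vnS mulnDr muln1.
apply: (leq_trans (leq_add ltM szS)); rewrite -cardsUI.
(* No vertex is charged twice: the roots of [M] have parent [v], which was not in [S]. *)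
have -> : M :&: [set x in V | under S (rho x)] = set0.
  apply/setP=> x; rewrite !inE; apply/negP=> /and3P[] /andP[_ /eqP pv] _.
  by rewrite /under pv /= (negPf vnS).
rewrite cards0 addn0; apply: subset_leq_card; apply/subsetP=> x.
rewrite in_setU !in_set; case/orP=> /andP[-> ux] /=.
  by rewrite /under (eqP ux) /= setU11.
by move: ux; rewrite /under; case: (p (rho x)) => //= s; apply: setU1r.
Qed.
End Separator.

(** * Lists of cliques and the pairs they cover *)

Section Realizes.
Variable T : finType.
Implicit Types (Q : seq {set T}) (E : rel T).

Definition codeg Q (x y : T) : nat :=
  \sum_(K <- Q) ((x \in K) && (y \in K)).

(** Such a list is a clique partition of [E]: codegree 0 off [E] makes the members cliques, and
    codegree 1 on [E] makes them edge-disjoint. Lists make codegrees additive under concatenation,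
    and members with fewer than two vertices are allowed. *)
Definition realizes Q E := forall x y, x != y -> codeg Q x y = E x y.

Lemma codeg_cat Q1 Q2 x y : codeg (Q1 ++ Q2) x y = codeg Q1 x y + codeg Q2 x y.
Proof. exact: big_cat. Qed.

Lemma codeg_flatten (I : finType) (f : I -> seq {set T}) x y :
  codeg (flatten [seq f i | i <- enum I]) x y = \sum_i codeg (f i) x y.
Proof. by rewrite /codeg big_flatten big_map big_enum. Qed.

Lemma codeg_map (I : finType) (f : I -> {set T}) x y :
  codeg [seq f i | i <- enum I] x y = #|[pred i | (x \in f i) && (y \in f i)]|.
Proof.
rewrite /codeg big_map big_enum -sum1_card [RHS]big_mkcond /=.
by apply: eq_bigr => i _; rewrite !inE; case: ifP.
Qed.

(** Every edge is its own clique; the bound counts ordered pairs. *)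
Lemma realize_pairs E : symmetric E ->
  exists2 Q, realizes Q E & size Q <= #|[set z : T * T | E z.1 z.2]|.
Proof.
move=> symE.
pose P := [set [set z.1; z.2] | z in [set z : T * T | E z.1 z.2 && (z.1 != z.2)]].
exists (enum P) => [x y nxy|]; last first.
  rewrite -cardE (leq_trans (leq_imset_card _ _)) //.
  by apply: subset_leq_card; apply/subsetP=> z; rewrite !inE => /andP[].
rewrite -[enum P]map_id.
rewrite /codeg big_map big_enum /=.
transitivity (\sum_(K in P) (K == [set x; y])).
  apply: eq_bigr => K /imsetP[[a b]]; rewrite inE /= => /andP[_ nab] ->.
  rewrite !inE; congr nat_of_bool; apply/andP/eqP => [[xab yab]|eab]; last first.
    by rewrite -!(in_set2 _ a b) eab set21 set22.
  case/orP: xab yab nxy => /eqP-> /orP[]/eqP->; rewrite ?eqxx // => _.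
  by rewrite setUC.
have [Exy|nExy] := boolP (E x y).
  rewrite (bigD1 [set x; y]) /=; last first.
    by apply/imsetP; exists (x, y); rewrite // inE /= Exy.
  by rewrite eqxx big1 // => K /andP[_ /negPf->].
rewrite big1 // => K /imsetP[[a b]]; rewrite inE /= => /andP[Eab _] ->.
case: eqP => // eab; case/negP: nExy; move: nxy.
have: x \in [set a; b] by rewrite eab set21.
have: y \in [set a; b] by rewrite eab set22.
move=> /set2P[]-> /set2P[]->; rewrite ?eqxx // => _; last by rewrite symE.
Qed.

(** Members with fewer than two vertices are dropped, so that blocks are nonempty. Two distinct
    members with a common edge would give it codegree at least 2. *)
Lemma realize_cp (F : sgraph T) Q :
  realizes Q (fun x y => ~~ F x y) -> cp (complement F) <= size Q.
Proof.
move=> QF; pose P := [set K | (K \in Q) && (1 < #|K|)].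
have two (K : {set T}) x y : x != y -> x \in K -> y \in K -> 1 < #|K|.
  by move=> nxy xK yK; apply/card_gt1P; exists x, y.
have cov K x y : K \in Q -> x != y -> x \in K -> y \in K -> ~~ F x y.
  move=> KQ nxy xK yK; have := QF x y nxy.
  by rewrite /codeg (big_rem K) //= xK yK; case: (F x y).
suff: clique_partition (complement F) P.
  move/cp_min/leq_trans; apply; apply: leq_trans (card_size Q).
  by apply: subset_leq_card; apply/subsetP=> K; rewrite !inE => /andP[].
apply/andP; split.
  apply/forall_inP=> K; rewrite inE => /andP[KQ _].
  apply/forall_inP=> x xK; apply/forall_inP=> y yK; apply/implyP=> nxy.
  by rewrite /= /compl_edge /= nxy (cov K).
apply/and3P; split.
- apply/eqP/setP=> e; apply/bigcupP/imsetP=> /=.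
    case=> _ /imsetP[K + ->]; rewrite inE => /andP[KQ _].
    case/imsetP=> -[x y]; rewrite inE /= => /and3P[xK yK nxy] ->.
    by exists (x, y); rewrite ?inE //= /compl_edge /= nxy (cov K).
  case=> -[x y]; rewrite inE /= /compl_edge /= => /andP[nxy nF] ->.
  have := QF x y nxy; rewrite nF /codeg => /eqP sum1.
  have /hasP[K KQ /andP[xK yK]] : has (fun K : {set T} => (x \in K) && (y \in K)) Q.
    apply: contraTT sum1 => /hasPn no; rewrite big_seq big1 // => K /no.
    by case: (_ && _).
  exists (clique_edges K).
    by apply: imset_f; rewrite inE KQ (two K x y).
  by apply/imsetP; exists (x, y); rewrite // inE /= xK yK.
- apply/trivIsetP=> _ _ /imsetP[K + ->] /imsetP[L + ->].
  rewrite !inE => /andP[KQ _] /andP[LQ _] neq.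
  rewrite -setI_eq0; apply/eqP/setP=> e; rewrite !inE.
  apply: contraNF neq => /andP[]/imsetP[[x y]].
  rewrite inE /= => /and3P[xK yK nxy] -> /imsetP[[a b]].
  rewrite inE /= => /and3P[aL bL _] exy.
  have xL : x \in L by have := set21 x y; rewrite exy => /set2P[]->.
  have yL : y \in L by have := set22 x y; rewrite exy => /set2P[]->.
  have := QF x y nxy; rewrite (cov K) // /codeg (big_rem K) //= xK yK.
  case: (eqVneq K L) => [->//|nKL].
  have Lr : L \in rem K Q.
    by move: LQ; rewrite (perm_mem (perm_to_rem KQ)) inE eq_sym (negPf nKL).
  by rewrite (big_rem L) //= xL yL.
- apply/imsetP=> -[K]; rewrite inE => /andP[_ /card_gt1P[x [y [xK yK nxy]]]].
  by move/setP/(_ [set x; y]); rewrite inE => /esym/imsetP; case; exists (x, y);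
    rewrite // inE /= xK yK.
Qed.
End Realizes.

(** * Placing the component roots in the affine plane *)

Lemma leq_cardCU (T : finType) (A B : {set T}) (a b n : nat) :
  #|A| <= a -> #|B| <= b -> n + a + b <= #|T| -> n <= #|~: (A :|: B)|.
Proof.
have := cardsC (A :|: B); have := (leq_card_setU A B).1; lia.
Qed.

Section Placement.
Variables (T : finType) (K : finFieldType).

Lemma light_fibre (R : {set T}) (f : T -> K) :
  exists b, #|K| * #|[set x in R | f x == b]| <= #|R|.
Proof.
case: (pickP [pred b | #|K| * #|[set x in R | f x == b]| <= #|R|]) => [b|no].
  by exists b.
have sumR : \sum_(b : K) #|[set x in R | f x == b]| = #|R|.
  rewrite -sum1_card (partition_big f predT) //=; apply: eq_bigr => b _.
  by rewrite -sum1_card; apply: eq_bigl => x; rewrite inE.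
have : \sum_(b : K) #|R|.+1 <= \sum_(b : K) #|K| * #|[set x in R | f x == b]|.
  by apply: leq_sum => b _; have /= /negbT := no b; rewrite -ltnNge.
rewrite -big_distrr /= sumR sum_nat_const leq_pmul2l ?ltnn //.
by apply/card_gt0P; exists 0%R.
Qed.

(** Markov's inequality for the column weights. *)
Lemma heavy_columns (h : nat) (R : {set T}) (X : T -> K) (w : T -> nat) :
  h * #|[set c | h < \sum_(x in R | X x == c) w x]| <= \sum_(x in R) w x.
Proof.
rewrite (partition_big X predT) //= mulnC -sum_nat_const.
rewrite [leqRHS](bigID (mem [set c | h < \sum_(x in R | X x == c) w x])) /=.
apply: leq_trans (leq_addr _ _); apply: leq_sum => c; rewrite inE; exact: ltnW.
Qed.

(* Roots are added in batches with a common label, each batch on a single line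
   with few occupied cells. *)
Lemma place_roots (J : finType) (label : T -> J) (slope : J -> K)
    (h : nat) (w : T -> nat) (R : {set T}) :
  #|K| = h.*2 -> {in R, forall x, 0 < w x <= h} ->
  4 * \sum_(x in R) w x <= h ^ 2 ->
  exists X Y : T -> K,
    [/\ {in R &, forall x y, X x = X y -> Y x = Y y -> x = y},
        forall c, \sum_(x in R | X x == c) w x <= h.*2 &
        exists2 L : {set J * K}, h * #|L| <= #|R| + h * #|label @: R| &
          {in R, forall x, (label x, Y x - slope (label x) * X x)%R \in L}].
Proof.
move=> cardK; have [n] := ubnP #|R|; elim: n R => // n IHn R leRn wh sumw.
have h_gt0 : 0 < h.
  by have : 0 < #|K| by [apply/card_gt0P; exists 0%R]; rewrite cardK; case: (h).
have [->|[x0 x0R]] := set_0Vmem R.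
  exists (fun=> 0%R), (fun=> 0%R); split=> [x y|c|]; first by rewrite inE.
    by rewrite big1 // => x; rewrite inE.
  by exists set0 => [|x]; rewrite ?cards0 ?muln0 ?inE.
pose C := [set x in R | label x == label x0].
(* A batch is a whole label class, or [h] elements of a larger class. Either way
   [#|R| + h * #|label @: R|] drops by at least [h], which pays for the one new pair in [L]. *)
have [B [sBC B_gt0 leBh Bbound]] : exists B : {set T},
    [/\ B \subset C, 0 < #|B|, #|B| <= h &
        #|R :\: B| + h * #|label @: (R :\: B)| + h <= #|R| + h * #|label @: R|].
  have x0C : x0 \in C by rewrite inE x0R eqxx.
  have [leCh|ltCh] := leqP #|C| h.
    exists C; split=> //; first by apply/card_gt0P; exists x0.
    have lt: #|label @: (R :\: C)| < #|label @: R|.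
      apply: proper_card; apply/properP; split; first exact/imsetS/subsetDl.
      exists (label x0); first exact: imset_f.
      by apply/imsetP=> -[x]; rewrite !inE => /andP[+ xR] eql; rewrite xR eql eqxx.
    have := subset_leq_card (subsetDl R C); nia.
  pose B := [set x in take h (enum C)].
  have cardB : #|B| = h.
    rewrite cardsE (card_uniqP _) ?take_uniq ?enum_uniq // size_take -cardE.
    by rewrite ltCh.
  have sBC : B \subset C.
    by apply/subsetP=> x; rewrite inE => /mem_take; rewrite mem_enum.
  exists B; rewrite cardB; split=> //.
  have := subset_leq_card (imsetS label (subsetDl R B)).
  have := cardsID B R; rewrite (setIidPr (subset_trans sBC _)) ?cardB; first nia.
  by apply/subsetP=> x; rewrite inE => /andP[].
have BR x : x \in B -> x \in R by move/(subsetP sBC); rewrite inE => /andP[].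
have sBR : B \subset R by apply/subsetP.
have labelB x : x \in B -> label x = label x0.
  by move/(subsetP sBC); rewrite inE => /andP[_ /eqP].
pose R' := R :\: B; have R'R x : x \in R' -> x \in R by rewrite inE => /andP[].
have sumR (P : pred T) :
    \sum_(x in R | P x) w x = \sum_(x in B | P x) w x + \sum_(x in R' | P x) w x.
  by rewrite (big_setIDcond _ _ B) /= (setIidPr sBR).
have sumR' : \sum_(x in R') w x <= \sum_(x in R) w x.
  by rewrite [leqRHS](big_setID B) leq_addl.
have [|x /R'R||X' [Y' [injXY colX [L lines LP]]]] := IHn R'; [|exact: wh|lia|].
  by have := cardsID B R; rewrite (setIidPr sBR) -/R'; lia.
pose m := slope (label x0).
(* By averaging over the parallel lines of slope [m], one of them has few occupied cells; it
   receives the batch. *)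
have [b light] := light_fibre R' (fun x => Y' x - m * X' x)%R.
set O := [set x in R' | _] in light.
pose H := [set c | h < \sum_(x in R' | X' x == c) w x].
have leH := heavy_columns h R' X' w; rewrite -/H in leH.
have leR' : #|R'| <= \sum_(x in R') w x.
  by rewrite -sum1_card; apply: leq_sum => x /R'R/wh/andP[].
(* The columns for [B] avoid those of weight above [h] and those whose cell on the line is taken.
   These number at most [h/4] and [h/8], so at least [h] of the [2h] columns remain. *)
have [g [injg gP]] : exists g : T -> K,
    {in B &, injective g} /\ {in B, forall x, g x \in ~: (H :|: X' @: O)}.
  apply: (exists_inj_on 0%R).
  have leH4 : 4 * #|H| <= h by rewrite -(leq_pmul2l h_gt0); lia.
  have leO8 : 8 * #|O| <= h by rewrite cardK in light; rewrite -(leq_pmul2l h_gt0); lia.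
  have leXO : #|X' @: O| <= #|O| by exact: leq_imset_card.
  apply: (leq_cardCU (leqnn #|H|) leXO).
  by rewrite cardK; lia.
exists (fun x => if x \in B then g x else X' x).
exists (fun x => if x \in B then m * g x + b else Y' x)%R.
have disj x y : x \in B -> y \in R -> y \notin B -> g x = X' y ->
    (m * g x + b)%R = Y' y -> False.
  move=> xB yR yB eX eY; have := gP x xB; rewrite !inE negb_or => /andP[_ /negP].
  apply; rewrite eX; apply: imset_f; rewrite !inE yB yR /= -eY -eX.
  by rewrite addrAC subrr add0r.
split=> [x y xR yR|c|].
- case: ifP => xB; case: ifP => yB.
  + by move=> /injg-> .
  + by move=> eX eY; case: (disj x y xB yR (negbT yB)).
  + by move=> /esym eX /esym eY; case: (disj y x yB xR (negbT xB)).
  + by apply: injXY; rewrite inE ?xB ?yB.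
- rewrite sumR.
  have -> : \sum_(x in R' | (if x \in B then g x else X' x) == c) w x =
            \sum_(x in R' | X' x == c) w x.
    by apply: eq_bigl => x; rewrite inE; case: (x \in B).
  have -> : \sum_(x in B | (if x \in B then g x else X' x) == c) w x =
            \sum_(x in B | g x == c) w x.
    by apply: eq_bigl => x; case: (x \in B).
  (* A column that receives a new root had weight at most [h], and gets just one root, itself of
     weight at most [h]. *)
  case: (pickP [pred x in B | g x == c]) => [x /andP[xB /eqP gx]|no]; last first.
    by rewrite big_pred0 // colX.
  have := gP x xB; rewrite gx !inE negb_or -leqNgt => /andP[leX _].
  rewrite (big_pred1 x) => [|y /=]; last first.
    apply/andP/eqP => [[yB /eqP gy]|->]; last by rewrite gx.
    by apply: injg; rewrite // gy.
  by have /andP[_] := wh x (BR x xB); lia.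
- exists ((label x0, b) |: L) => [|x xR]; last first.
    case: ifP => xB; first by rewrite labelB // addrAC subrr add0r setU11.
    by apply/setU1r/LP; rewrite inE xB.
  have leL : #|(label x0, b) |: L| <= 1 + #|L|.
    by rewrite cardsU1 leq_add2r leq_b1.
  apply: leq_trans (_ : h * (1 + #|L|) <= _); first by rewrite leq_mul2l leL orbT.
  by rewrite mulnDr muln1; rewrite -/R' in Bbound; lia.
Qed.
End Placement.

(** * The clique decomposition given by an affine plane *)

Section Step.
Variables (T : finType) (F : sgraph T) (K : finFieldType).

Definition compl_on (A : {set T}) : rel T :=
  fun x y => [&& x \in A, y \in A & ~~ F x y].

Variables (A S : {set T}) (X Y mu : T -> K).
Let V := A :\: S.
Hypothesis sSA : S \subset A.
Hypothesis injmu : {in S &, injective mu}.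
Hypothesis injXY : {in V &, forall x y, X x = X y -> Y x = Y y -> x = y}.
Hypothesis FX : {in V &, forall x y, F x y -> X x = X y}.
Variable Bd : {set T * K}.

(** Together with [mu s], it names the line joining the point [x] to the point at infinity [s]. *)
Definition intercept (s x : T) : K := (Y x - mu s * X x)%R.

Hypothesis FBd : {in S & V, forall s x, F s x -> (s, intercept s x) \in Bd}.

(* The vertex s is the point at infinity of slope [mu s]; it is left out of the
   lines listed in [Bd]. *)
Definition line (l : K * K) : {set T} :=
  [set x in V | (Y x - l.1 * X x)%R == l.2] :|:
  [set s in S | (mu s == l.1) && ((s, l.2) \notin Bd)].

Let VS x : x \in V -> x \notin S. Proof. by rewrite !inE => /andP[]. Qed.

Let lineV x l : x \in V -> (x \in line l) = ((Y x - l.1 * X x)%R == l.2).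
Proof. by move=> xV; rewrite in_setU !in_set -in_setD xV (negPf (VS xV)) orbF. Qed.

Let lineS s l : s \in S -> (s \in line l) = (mu s == l.1) && ((s, l.2) \notin Bd).
Proof. by move=> sS; rewrite in_setU !in_set sS. Qed.

Let lineA x l : x \in line l -> x \in A.
Proof.
by rewrite !inE => /orP[/andP[/andP[_ ->]]|/andP[/(subsetP sSA)]].
Qed.

Let lines := [seq line l | l <- enum {: K * K}].

(** Two points span exactly one line; it is vertical, hence not listed, when they share a column. *)
Let codeg_linesV x y : x != y -> x \in V -> y \in V ->
  codeg lines x y = (X x != X y).
Proof.
move=> nxy xV yV; rewrite codeg_map; have [eX|neX] := eqVneq (X x) (X y).
  apply: eq_card0 => l; rewrite inE /= !lineV //; apply/negP=> /andP[/eqP lx].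
  rewrite -lx eX => /eqP/addIr/esym eY; case/eqP: nxy; exact: injXY.
have nz : (X y - X x != 0)%R by rewrite subr_eq0 eq_sym.
pose m := ((Y y - Y x) / (X y - X x))%R.
apply: (@eq_card1 _ (m, Y x - m * X x)%R) => -[a b]; rewrite inE /= !lineV //=.
have onl a' : (Y x - a' * X x == Y y - a' * X y)%R = (a' == m).
  rewrite -subr_eq0 opprD opprK addrACA [(- _ + _)%R]addrC -opprB -mulrBr.
  by rewrite addrC subr_eq0 -{1}(divfK nz (Y y - Y x)%R) (inj_eq (mulIf nz)).
rewrite [RHS]inE xpair_eqE; apply/andP/andP=> [[/eqP lx ly]|[am /eqP->]].
  have am : a == m by rewrite -onl lx eq_sym.
  by rewrite am -(eqP am) lx.
by have := am; rewrite -onl => /eqP <-; rewrite (eqP am).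
Qed.

Let codeg_linesSV s x : s \in S -> x \in V ->
  codeg lines s x = ((s, intercept s x) \notin Bd).
Proof.
move=> sS xV; rewrite codeg_map; have [sBd|sBd] := boolP (_ \in Bd).
  apply: eq_card0 => l; rewrite inE /= lineS // lineV //; apply/negP.
  by case/andP=> /andP[/eqP em + /eqP eb]; rewrite -eb -em sBd.
apply: (@eq_card1 _ (mu s, intercept s x)) => -[a b].
rewrite inE /= lineS // lineV //= [RHS]inE xpair_eqE.
apply/andP/andP=> [[/andP[/eqP<- _] /eqP<-]|[/eqP-> /eqP->]]; first by rewrite !eqxx.
by rewrite !eqxx sBd.
Qed.

Let codeg_linesS s t : s != t -> s \in S -> t \in S -> codeg lines s t = 0.
Proof.
move=> nst sS tS; rewrite codeg_map; apply: eq_card0 => l; rewrite inE /= !lineS //.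
apply/negP=> /andP[/andP[/eqP<- _] /andP[/eqP em _]].
by case/eqP: nst; apply: injmu.
Qed.

Let codeg_lines_out x y : ~~ ((x \in A) && (y \in A)) -> codeg lines x y = 0.
Proof.
move=> nA; rewrite codeg_map; apply: eq_card0 => l; rewrite inE /=.
by apply: contraNF nA => /andP[/lineA-> /lineA->].
Qed.

Lemma codegC Q (x y : T) : codeg Q x y = codeg Q y x.
Proof. by apply: eq_bigr => K' _; rewrite andbC. Qed.

(** The nonadjacent pairs lost by leaving a vertex of [S] out of the lines in [Bd]. With the pairs
    inside [S], they form the [residue] that is covered edge by edge. *)
Let halfres x y := [&& x \in S, y \in V, ~~ F x y & (x, intercept x y) \in Bd].
Let residue x y := [|| compl_on S x y, halfres x y | halfres y x].

Let residue_sym : symmetric residue.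
Proof.
by move=> x y; rewrite /residue /compl_on andbCA edge_sym [halfres _ _ || _]orbC.
Qed.

Let residue_card :
  #|[set z | residue z.1 z.2]| <= #|S| ^ 2 + 2 * (#|Bd| * #|{: K}|).
Proof.
pose H := [set z | halfres z.1 z.2].
have leH : #|H| <= #|Bd| * #|{: K}|.
  rewrite -cardsT -cardsX.
  (* A lost pair is determined by its exceptional line and a column, since a non-vertical line meets
     each column once. *)
  pose f (z : T * T) := ((z.1, intercept z.1 z.2), X z.2).
  have injf : {in H &, injective f}.
    move=> [s x] [t y]; rewrite !inE /f /= => /and4P[_ xV _ _] /and4P[_ yV _ _].
    case=> <-; rewrite /intercept => + eX; rewrite eX => /addIr eY.
    by rewrite (injXY xV yV).
  rewrite -(card_in_imset injf); apply/subset_leq_card/subsetP=> _ /imsetP[z + ->].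
  by rewrite !inE => /and4P[_ _ _ ->].
pose H' := [set (z.2, z.1) | z in H].
have leH' : #|H'| <= #|Bd| * #|{: K}| by rewrite (leq_trans (leq_imset_card _ _)).
have := (leq_card_setU (setX S S) (H :|: H')).1.
have := (leq_card_setU H H').1; rewrite cardsX.
suff : #|[set z | residue z.1 z.2]| <= #|setX S S :|: (H :|: H')|.
  rewrite mulnn; lia.
apply/subset_leq_card/subsetP=> -[x y]; rewrite !inE /= => /or3P[/and3P[-> -> _]//|->|yx].
  by rewrite orbT.
by apply/orP; right; apply/orP; right; apply/imsetP; exists (y, x); rewrite ?inE.
Qed.

(** Pairs in one column are left to [Q]. Pairs in different columns are nonadjacent by [FX] and lie
    on one line. Pairs between [S] and [V] lie on one line or in the residue, adjacent ones being
    kept off the lines by [FBd]. Pairs inside [S] are in the residue. *)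
Lemma plane_step (Q : K -> seq {set T}) :
  (forall c, realizes (Q c) (compl_on [set x in V | X x == c])) ->
  exists2 Q', realizes Q' (compl_on A) &
    size Q' <= \sum_c size (Q c) + #|{: K}| ^ 2 + #|S| ^ 2 + 2 * (#|Bd| * #|{: K}|).
Proof.
move=> QP; have [Q2 Q2P szQ2] := realize_pairs residue_sym.
exists (flatten [seq Q c | c <- enum {: K}] ++ lines ++ Q2); last first.
  rewrite !size_cat size_flatten /shape -map_comp sumnE big_map big_enum /=.
  rewrite size_map -cardE card_prod mulnn -!addnA.
  exact/leq_add/leq_add/(leq_trans szQ2 residue_card).
move=> x y nxy; rewrite !codeg_cat codeg_flatten Q2P //.
have -> : \sum_c codeg (Q c) x y =
          [&& x \in V, y \in V, X x == X y & ~~ F x y].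
  rewrite (eq_bigr _ (fun c _ => QP c x y nxy)) (bigD1 (X x)) //=.
  rewrite /compl_on !in_set eqxx andbT big1 ?addn0; last first.
    by move=> c ncx; rewrite !in_set eq_sym (negPf ncx) andbF.
  by rewrite [X x == X y]eq_sym -!andbA; do !case: (_ \in _) => //=; rewrite andbCA.
have AE z : z \in A = (z \in V) || (z \in S).
  by rewrite inE; case: (boolP (z \in S)) => [/(subsetP sSA)->|]; rewrite ?orbF.
have SV z : z \in S -> (z \in V) = false by rewrite inE => ->.
rewrite /residue /halfres /compl_on !AE.
have := codeg_lines_out (x := x) (y := y); rewrite !AE.
case: (boolP (x \in S)) => xS; case: (boolP (y \in S)) => yS.
- by rewrite !SV //= => _; rewrite codeg_linesS // !orbF.
- rewrite (SV x) //=; case: (boolP (y \in V)) => yV /=; last by move=> ->.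
  rewrite codeg_linesSV // orbF => _.
  case Fxy: (F x y) => /=; first by rewrite FBd.
  by case: (_ \in Bd).
- rewrite (SV y) //=; case: (boolP (x \in V)) => xV /=; last by move=> ->.
  rewrite codegC codeg_linesSV // [F x y]edge_sym => _.
  case Fxy: (F y x) => /=; first by rewrite FBd.
  by case: (_ \in Bd).
- case: (boolP (x \in V)) => xV /=; last by move=> ->.
  case: (boolP (y \in V)) => yV /=; last by move=> ->.
  rewrite codeg_linesV // => _; case: eqVneq => [eX|neX] /=; first by rewrite !addn0.
  by case Fxy: (F x y) => //; case/eqP: neX; apply: FX.
Qed.

End Step.

(** * One step of the recursion for a forest *)

Section ForestStep.
Variables (T : finType) (F : sgraph T) (p : T -> option T) (r : T -> nat).
Hypothesis pF : forall x y, F x y -> p x = Some y \/ p y = Some x.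
Hypothesis pr : forall x y, p x = Some y -> r x < r y.

Lemma sum_card_fibres (I : finType) (V : {set T}) (f : T -> I) (P : pred I) :
  \sum_(i | P i) #|[set x in V | f x == i]| = #|[set x in V | P (f x)]|.
Proof.
rewrite -sum1_card (partition_big f P) => [|x]; last by rewrite inE => /andP[].
apply: eq_bigr => i Pi; rewrite -sum1_card; apply: eq_bigl => x.
by rewrite !inE -andbA; case: eqP => [->|]; rewrite ?Pi ?andbT ?andbF.
Qed.

Lemma forest_step (K : finFieldType) (h m : nat) (A : {set T}) :
  #|{: K}| = h.*2 -> 4 * #|A| <= h ^ 2 ->
  (forall A' : {set T}, #|A'| <= h.*2 ->
     exists2 Q, realizes Q (compl_on F A') & size Q <= m * #|A'|) ->
  exists2 Q, realizes Q (compl_on F A) & size Q <= m * #|A| + 13 * h ^ 2.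
Proof.
move=> cardK leA IH.
have h_gt0 : 0 < h.
  by have : 0 < #|{: K}|; [apply/card_gt0P; exists 0%R|rewrite cardK; case: (h)].
have [S [rho [sSA rhoV rhoF rhoN [fib szS]]]] := separator pF pr h A.
set V := A :\: S in rhoV rhoF rhoN fib szS.
have leVA : #|V| <= #|A| by rewrite subset_leq_card ?subsetDl.
(* The separator gives [h * #|S| <= #|V|], and [4 * #|V| <= h ^ 2]. *)
have leS : 4 * #|S| <= h.
  have : #|[set x in V | under p S (rho x)]| <= #|V|.
    by apply/subset_leq_card/subsetP=> x; rewrite inE => /andP[].
  by move=> le; rewrite -(leq_pmul2l h_gt0) mulnn; lia.
pose R := [set x in V | rho x == x].
have RV x : x \in R -> x \in V by rewrite inE => /andP[].
have rhoR x : x \in V -> rho x \in R.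
  by move=> xV; have [rV rr] := rhoV x xV; rewrite inE rV rr eqxx.
pose w x := #|[set y in V | rho y == x]|.
have sumw (P : pred T) : \sum_(x in R | P x) w x = #|[set x in V | P (rho x)]|.
  rewrite sum_card_fibres; apply: eq_card => x; rewrite inE [RHS]inE.
  by case: (boolP (x \in V)) => //= xV; rewrite rhoR.
have [mu [injmu _]] : exists mu : T -> K, {in S &, injective mu} /\
    {in S, forall x, mu x \in setT}.
  by apply: (exists_inj_on 0%R); rewrite cardsT cardK; lia.
(* Roots with no parent in [S] share the label [None], with the arbitrary slope 0. *)
pose label x := if p x is Some s then if s \in S then Some s else None else None.
pose slope o := if o is Some s then mu s else 0%R.
have [|x xR||X0 [Y0 [inj0 col0 [L leL LP]]]] :=
    @place_roots T K (option T) label slope h w R.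
- exact: cardK.
- rewrite fib andbT; apply/card_gt0P; exists x.
  by move: xR; rewrite !inE.
- have -> : \sum_(x in R) w x = #|V|; last lia.
  rewrite -[RHS](eq_card (A := [set x in V | predT (rho x)])) -?sumw; last first.
    by move=> x; rewrite inE andbT.
  by apply: eq_bigl => x; rewrite andbT.
(* A whole component goes into the column of its root. *)
pose X x := X0 (rho x).
have leV c : #|[set x in V | X x == c]| <= h.*2.
  by rewrite -(sumw (fun x => X0 x == c)) col0.
have XR x : x \in R -> X x = X0 x by rewrite /X inE => /andP[_ /eqP->].
(* Roots keep their cells; the other vertices of a column fill its remaining cells, of which there
   are enough because the column has at most [2h] vertices. *)
have [g injg gE] : exists2 g : K -> T -> K,
    forall c, {in [set x in V | X x == c] &, injective (g c)} &
    forall c, {in [set x in R | X x == c], g c =1 Y0}.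
  apply: (@fin_all_exists2 _ _ (fun c (f : T -> K) =>
    {in [set x in V | X x == c] &, injective f}) (fun c (f : T -> K) =>
    {in [set x in R | X x == c], f =1 Y0})) => c.
  apply: (extend_inj_on 0%R); last by rewrite cardK.
    by apply/subsetP=> x; rewrite !in_set => /andP[/andP[-> _] ->].
  move=> x y; rewrite in_set => /andP[xR /eqP xc]; rewrite in_set => /andP[yR /eqP yc].
  by apply: inj0; rewrite -?XR // xc yc.
pose Y x := g (X x) x.
(* A vertex of [S] has at most one neighbour above it, costing one exceptional line; its neighbours
   below are roots, whose lines are recorded in [L]. *)
pose up s := (s, if p s is Some v then intercept X Y mu s v else 0%R).
pose Bd : {set T * K} := (up @: S) :|: [set z | (Some z.1, z.2) \in L].
have injXY : {in V &, forall x y, X x = X y -> Y x = Y y -> x = y}.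
  move=> x y xV yV eX; rewrite /Y -eX; apply: injg; rewrite in_set ?xV ?yV /=.
    by rewrite eqxx.
  by rewrite eX eqxx.
have FX : {in V &, forall x y, F x y -> X x = X y}.
  by move=> x y xV yV Fxy; rewrite /X (rhoF x y).
have FBd : {in S & V, forall s x, F s x -> (s, intercept X Y mu s x) \in Bd}.
  move=> s x sS xV /pF[ps|px]; rewrite inE.
    by apply/orP; left; apply/imsetP; exists s; rewrite // /up ps.
  apply/orP; right; rewrite inE /=.
  have xR : x \in R.
    rewrite inE xV /=; apply: contraT => /(rhoN _ xV)[y yV].
    by rewrite px => -[sy]; move: yV; rewrite -sy inE sS.
  have := LP x xR; rewrite /label px sS /= /intercept -(XR x xR).
  by rewrite /Y gE // in_set xR eqxx.
(* The lines to parents number at most [h/4], and those to roots at most [h/4 + 1 + h/4]. *)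
have leBd : #|Bd| <= 2 * h.
  have leup : #|up @: S| <= #|S| by exact: leq_imset_card.
  have leL' : #|[set z : T * K | (Some z.1, z.2) \in L]| <= #|L|.
    pose f (z : T * K) := (Some z.1, z.2).
    have injf : injective f by move=> [s b] [t c] [-> ->].
    rewrite -(card_imset _ injf); apply/subset_leq_card/subsetP=> _ /imsetP[z + ->].
    by rewrite inE.
  have leJ : #|label @: R| <= 1 + #|S|.
    apply: leq_trans (_ : #|None |: [set Some s | s in S]| <= _); last first.
      by rewrite cardsU1 leq_add ?leq_b1 ?leq_imset_card.
    apply/subset_leq_card/subsetP=> _ /imsetP[x _ ->]; rewrite /label.
    case: (p x) => [s|]; last by rewrite setU11.
    by case: ifP => sS; rewrite ?setU11 // setU1r // imset_f.
  have leRV : #|R| <= #|V| by apply/subset_leq_card/subsetP.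
  have leLS : h * #|L| <= #|R| + h * (1 + #|S|).
    by apply: leq_trans leL _; rewrite leq_add2l leq_mul2l leJ orbT.
  have leL4 : 4 * #|L| <= h + 4 * (1 + #|S|).
    by rewrite -(leq_pmul2l h_gt0); rewrite -mulnn in leA; lia.
  apply: (leq_trans (leq_card_setU _ _).1).
  by apply: (leq_trans (leq_add leup leL')); lia.
have [Q QP szQ] : exists2 Q : K -> seq {set T},
    forall c, realizes (Q c) (compl_on F [set x in V | X x == c]) &
    forall c, size (Q c) <= m * #|[set x in V | X x == c]|.
  apply: (@fin_all_exists2 _ _
    (fun c (Q : seq {set T}) => realizes Q (compl_on F [set x in V | X x == c]))
    (fun c (Q : seq {set T}) => size Q <= m * #|[set x in V | X x == c]|)) => c.
  exact: IH.
have [Q' Q'P szQ'] := plane_step sSA injmu injXY FX FBd QP.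
exists Q' => //; apply: (leq_trans szQ').
have : \sum_c size (Q c) <= m * #|A|.
  apply: leq_trans (_ : \sum_c m * #|[set x in V | X x == c]| <= _).
    by apply: leq_sum => c _; apply: szQ.
  rewrite -big_distrr leq_mul2l /=; apply/orP; right; apply: leq_trans leVA.
  rewrite (sum_card_fibres V X predT).
  by apply/subset_leq_card/subsetP=> x; rewrite inE andbT.
have : #|Bd| * #|{: K}| <= 2 * h * h.*2 by rewrite cardK leq_mul2r leBd orbT.
have : #|S| ^ 2 <= h ^ 2 by rewrite leq_sqr; lia.
(* The constant is 13 = 4 + 1 + 8: the lines, the pairs inside [S], and twice the lost pairs. *)
rewrite cardK -!mulnn; nia.
Qed.
End ForestStep.

(** * The recursion and its depth *)

Section Recursion.
Variables (T : finType) (F : sgraph T).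

Lemma realize_small (A : {set T}) :
  exists2 Q, realizes Q (compl_on F A) & size Q <= #|A| * #|A|.
Proof.
have [|Q QP szQ] := @realize_pairs T (compl_on F A).
  by move=> x y; rewrite /compl_on andbCA edge_sym.
exists Q => //; apply: (leq_trans szQ); rewrite -cardsX.
by apply/subset_leq_card/subsetP=> -[x y]; rewrite !inE => /and3P[-> ->].
Qed.

(** The summand 4 in the exponent absorbs the constant between the square root of [#|A|] and the
    column size. The base case has at most 32 vertices, and each level costs 208 = 13 * 16 per
    vertex. *)
Lemma forest_cover (i : nat) (A : {set T}) : forest F -> #|A| <= 2 ^ (2 ^ i + 4) ->
  exists2 Q, realizes Q (compl_on F A) & size Q <= (32 + 208 * i) * #|A|.
Proof.
move=> /forest_parent[p [r [pF pr]]]; elim: i A => [|i IHi] A leA.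
  have [Q QP szQ] := realize_small A.
  by exists Q => //; apply: (leq_trans szQ); rewrite leq_mul2r leA orbT.
have [A0|A_gt0] := posnP #|A|.
  by have [Q QP szQ] := realize_small A; exists Q; rewrite // A0 ?muln0 in szQ *.
(* With [h = 2 ^ k], [high] says [4 * #|A| <= h ^ 2], as the plane requires, and [low] says
   [h ^ 2 < 16 * #|A|], which bounds the cost. *)
have [k low high] : exists2 k, 4 ^ k < 16 * #|A| & 16 * #|A| <= 4 ^ k.+1.
  have := @up_log_bounds 4 (16 * #|A|) isT; have := up_log_gt0 4 (16 * #|A|).
  case: (up_log _ _) => [|k] /=; first lia.
  by move=> _ /(_ ltac:(lia)) /andP[? ?]; exists k.
have [K _ cardK] := pPrimePowerField (isT : prime 2) (ltn0Sn k).
have h2 : (2 ^ k) ^ 2 = 4 ^ k by rewrite -expnM mulnC expnM.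
(* From [low], [2k < 2 ^ i.+1 + 8], that is [k < 2 ^ i + 4]. *)
have le_k : 2 ^ k.+1 <= 2 ^ (2 ^ i + 4).
  rewrite leq_exp2l // -(ltn_exp2l (m := 4)) //; apply: (leq_trans low).
  apply: leq_trans (_ : 16 * 2 ^ (2 ^ i.+1 + 4) <= _); first by rewrite leq_mul2l.
  by rewrite -[16]/(2 ^ 4) -[4 in leqRHS]/(2 ^ 2) -expnD -expnM leq_exp2l // expnS; lia.
have cardK2 : #|{: K}| = (2 ^ k).*2 by rewrite cardK expnS mul2n.
have [||Q QP szQ] := forest_step (m := 32 + 208 * i) (A := A) pF pr cardK2.
- by move: high; rewrite h2 expnS; lia.
- by move=> A' leA'; apply: IHi; apply: leq_trans leA' _; rewrite -mul2n -expnS.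
by exists Q => //; move: szQ; rewrite h2; nia.
Qed.

Lemma cp_complement_forest (i : nat) : forest F -> #|T| <= 2 ^ (2 ^ i) ->
  cp (complement F) <= (32 + 208 * i) * #|T|.
Proof.
move=> forF leT; have [|Q QP szQ] := @forest_cover i setT forF.
  by rewrite cardsT (leq_trans leT) // leq_exp2l // leq_addr.
rewrite cardsT in szQ; apply: leq_trans szQ; apply: realize_cp => x y nxy.
by rewrite QP // /compl_on !in_setT.
Qed.

End Recursion.

(** * Passage to real logarithms *)

Local Open Scope ring_scope.

Lemma log2_ge (R : realType) (k : nat) (x : R) : 2 ^+ k <= x -> k%:R <= log2 x.
Proof.
move=> lekx; have x_gt0 : 0 < x by rewrite (lt_le_trans _ lekx) // exprn_gt0.
have ln2 : 0 < ln (2 : R) by rewrite ln_gt0 // ltr1n.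
rewrite /log2 ler_pdivlMr // mulr_natl -lnXn //.
by rewrite ler_ln ?posrE // exprn_gt0.
Qed.

Theorem theorem6p1 (R : realType) :
  exists C : R, forall (n : nat) (T : finType) (F : sgraph T),
    (4 <= n)%N -> #|T| = n -> forest F ->
    (cp (complement F))%:R <= C * n%:R * log2 (log2 (n%:R : R)).
Proof.
(* The cost per vertex is [32 + 208 * j.+1 = 240 + 208 * j], and both 1 and [j] are at most the
   iterated logarithm of [n]; 448 = 240 + 208. *)
exists 448%:R => n T F n4 cardT forF.
have [j low high] : exists2 j : nat, (2 ^ 2 ^ j <= n)%N & (n <= 2 ^ 2 ^ j.+1)%N.
  have ex : exists j, (n <= 2 ^ 2 ^ j)%N.
    exists n; apply/ltnW/(ltn_trans (ltn_expl n (isT : 1 < 2)%N)).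
    by rewrite ltn_exp2l // ltn_expl.
  (* The least exponent is not 0, because [n] is at least 4. *)
  case: (ex_minnP ex) => -[|j] lej minj; first by move: lej; lia.
  by exists j => //; rewrite leqNgt; apply/negP => /ltnW/minj; rewrite ltnn.
pose l := log2 (log2 (n%:R : R)).
have lj : j%:R <= l.
  by apply: log2_ge; rewrite -natrX; apply: log2_ge; rewrite -natrX ler_nat.
have l1 : 1 <= l.
  by apply: (@log2_ge R 1); apply: (@log2_ge R 2); rewrite -natrX ler_nat.
have := cp_complement_forest forF (i := j.+1); rewrite cardT => /(_ high).
rewrite -(ler_nat R) natrM => /le_trans; apply.
rewrite mulrAC ler_wpM2r // mulnS addnA natrD natrM.
have -> : 448%:R * l = 240%:R * l + 208%:R * l by rewrite -mulrDl -natrD.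
by apply: lerD; [rewrite ler_peMr|rewrite ler_wpM2l].
Qed.
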